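(* For every nonnegative integer $n$ and every integer $p$ with $0\leq p\leq n$: $$\sum_{k=p+1}^n \frac{1}{k-p}H_{n-k} = H_{n-p}^2 - H_{n-p}^{(2)} .$$
   Context: For a nonnegative integer $n$ and a positive integer $m$, the generalized harmonic number is $H_n^{(m)} = \sum_{k=1}^n \frac{1}{k^m}$, so that $H_0^{(m)}=0$. The traditional harmonic number is $H_n = H_n^{(1)}$. $H_n^2$ denotes the ordinary square $(H_n)^2$, while the parenthesized superscript in $H_n^{(2)}$ denotes the order. Empty sums (upper limit less than lower limit) are zero. *)

(* Defs.v *)
From mathcomp Require Import all_boot all_order all_algebra.

Set Implicit Arguments.
Unset Strict Implicit.
Unset Printing Implicit Defensive.

Import GRing.Theory.
Local Open Scope ring_scope.

(* H_n^(m); only orders m > 0 are meaningful here. *)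
Definition gen_harmonic (m n : nat) : rat :=
  \sum_(1 <= k < n.+1) 1 / (k%:R ^+ m).

Definition harmonic_number (n : nat) : rat := gen_harmonic 1 n.

(* Main.v *)
Require Import Defs.
From mathcomp Require Import all_boot all_order all_algebra.
From mathcomp Require Import ring zify.

Import GRing.Theory Num.Theory.
Local Open Scope ring_scope.

(** The shift [k = p + j] removes [p], so with [N = n - p] one has to evaluate
    the convolution [S_N = \sum_(1 <= j <= N) H_(N-j) / j].  Passing from [N] to
    [N + 1], each [H_(N-j)] gains its next term [1 / (N + 1 - j)] and the new
    summand vanishes because [H_0 = 0].  By partial fractions,
    [1 / (j (N+1-j)) = (1 / j + 1 / (N+1-j)) / (N+1)], and both halves sum to
    [H_N]; so [S_N] grows by [2 H_N / (N+1)] ([sum_inv_mul_inv_rev]).  This is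
    also the growth of [H_N ^ 2 - H_N^(2)], since
    [(H_N + 1/(N+1)) ^ 2 = H_N ^ 2 + 2 H_N / (N+1) + 1 / (N+1) ^ 2]. *)

Lemma gen_harmonic0 (m : nat) : gen_harmonic m 0 = 0.
Proof. by rewrite /gen_harmonic big_geq. Qed.

Lemma gen_harmonicS (m n : nat) :
  gen_harmonic m n.+1 = gen_harmonic m n + 1 / (n.+1%:R ^+ m).
Proof. by rewrite /gen_harmonic big_nat_recr. Qed.

Lemma harmonic_numberS (n : nat) :
  harmonic_number n.+1 = harmonic_number n + 1 / n.+1%:R.
Proof. by rewrite /harmonic_number gen_harmonicS expr1. Qed.

Lemma harmonic_number_sum_inv (n : nat) :
  harmonic_number n = \sum_(0 <= j < n) 1 / j.+1%:R.
Proof.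
rewrite /harmonic_number /gen_harmonic big_add1 /=.
by apply: eq_bigr => j _; rewrite expr1.
Qed.

Lemma harmonic_number_sum_inv_rev (n : nat) :
  harmonic_number n = \sum_(0 <= j < n) 1 / (n - j)%:R.
Proof.
rewrite harmonic_number_sum_inv big_nat_rev /= add0n !big_nat.
by apply: eq_bigr => j /andP[_ ltjn]; rewrite subnSK.
Qed.

(** The two factors of each denominator have the constant sum [n + 1], so
    partial fractions split the sum into [H_n] and its reversal. *)
Lemma sum_inv_mul_inv_rev (n : nat) :
  \sum_(0 <= j < n) (1 / j.+1%:R) * (1 / (n - j)%:R)
  = 2 * harmonic_number n / n.+1%:R.
Proof.
rewrite mulr_natl mulr2n {1}harmonic_number_sum_inv harmonic_number_sum_inv_rev.
rewrite -big_split mulr_suml /= !big_nat; apply: eq_bigr => j /andP[_ ltjn].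
have -> : n.+1%:R = j.+1%:R + (n - j)%:R :> rat.
  by rewrite -natrD; congr (_%:R); lia.
have j1_neq0 : j.+1%:R != 0 :> rat by rewrite pnatr_eq0.
have nj_neq0 : (n - j)%:R != 0 :> rat by rewrite pnatr_eq0; lia.
have sum_neq0 : j.+1%:R + (n - j)%:R != 0 :> rat by rewrite -natrD pnatr_eq0.
move: (j.+1%:R) ((n - j)%:R) j1_neq0 nj_neq0 sum_neq0 => a b a0 b0 ab0.
by field; rewrite a0 b0 ab0.
Qed.

(** Induction on [n] works here because [p] has been shifted away: only the
    harmonic numbers, not the weights [1 / (j + 1)], change with [n]. *)
Lemma harmonic_convolution (n : nat) :
  \sum_(0 <= j < n) 1 / j.+1%:R * harmonic_number (n - j.+1)
  = harmonic_number n ^+ 2 - gen_harmonic 2 n.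
Proof.
elim: n => [|n IHn].
  by rewrite big_geq // /harmonic_number !gen_harmonic0 expr0n subr0.
rewrite big_nat_recr //= subnn {2}/harmonic_number gen_harmonic0 mulr0 addr0.
have -> : \sum_(0 <= j < n) 1 / j.+1%:R * harmonic_number (n.+1 - j.+1)
        = \sum_(0 <= j < n) 1 / j.+1%:R * harmonic_number (n - j.+1)
          + \sum_(0 <= j < n) (1 / j.+1%:R) * (1 / (n - j)%:R).
  rewrite -big_split /= !big_nat; apply: eq_bigr => j /andP[_ ltjn].
  by rewrite subSS -(subnSK ltjn) harmonic_numberS mulrDr.
rewrite IHn sum_inv_mul_inv_rev harmonic_numberS gen_harmonicS.
have n1_neq0 : n.+1%:R != 0 :> rat by rewrite pnatr_eq0.
by move: (n.+1%:R) n1_neq0 => a a_neq0; field.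
Qed.

(* All natural-number subtractions are exact, since p <= n and k <= n. *)
Theorem theorem2p4 (n p : nat) (hpn : (p <= n)%N) :
  \sum_(p.+1 <= k < n.+1) 1 / (k%:R - p%:R) * harmonic_number (n - k)%N
  = harmonic_number (n - p)%N ^+ 2 - gen_harmonic 2 (n - p)%N.
Proof.
rewrite -harmonic_convolution -[p.+1]add0n big_addn subSS.
apply: eq_bigr => j _.
have -> : (j + p.+1)%:R - p%:R = j.+1%:R :> rat.
  by rewrite addnS -addSn natrD addrK.
by congr (_ * harmonic_number _); lia.
Qed.
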